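(* Let $\mathcal{A}$ and $\mathcal{B}$ be Banach algebras, let $\varphi:\mathcal{A}\to\mathcal{B}$ be a bounded homomorphism, and suppose that $\mathcal{A}$ is zero product determined and has a bounded approximate identity. Then the graph $\mathcal{G}=\{(a,\varphi(a)):a\in\mathcal{A}\}$ is a zero product determined Banach algebra.
   Context: The graph $\mathcal{G}$ is a Banach algebra with norm $\|(a,\varphi(a))\|_1=\|a\|_{\mathcal{A}}+\|\varphi(a)\|_{\mathcal{B}}$ and coordinatewise operations $(a,\varphi(a))+(b,\varphi(b))=(a+b,\varphi(a+b))$, $(a,\varphi(a))(b,\varphi(b))=(ab,\varphi(a)\varphi(b))=(ab,\varphi(ab))$. A Banach algebra $\mathcal{A}$ is zero product determined if for every continuous bilinear functional $\psi:\mathcal{A}\times\mathcal{A}\to\mathbb{C}$ such that $\psi(x,y)=0$ whenever $xy=0$, there is a continuous linear functional $\tau$ on $\mathcal{A}$ with $\psi(x,y)=\tau(xy)$ for all $x,y\in\mathcal{A}$. *)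

(* Defs.v *)
From HB Require Import structures.
From mathcomp Require Import all_boot all_order all_algebra.
From mathcomp Require Import complex.
From mathcomp Require Import all_classical all_reals all_analysis.

Set Implicit Arguments.
Unset Strict Implicit.
Unset Printing Implicit Defensive.

Import Order.TTheory GRing.Theory Num.Theory.
Import numFieldNormedType.Exports.

Local Open Scope classical_set_scope.
Local Open Scope ring_scope.
Local Open Scope complex_scope.

(* Complex Banach algebras, not assumed unital: MathComp's algType requires a
   unit, so the product is a separate operation.  The complex numbers are R[i]
   for R : realType, and norms take their (real, nonnegative) values in R[i]. *)
HB.mixin Record CompleteNormedModule_isBanachAlgebra (R : realType) A
    of CompleteNormedModule R[i] A := {
  bmul : A -> A -> A;
  bmulA : associative bmul;
  bmulDl : left_distributive bmul +%R;
  bmulDr : right_distributive bmul +%R;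
  bmulZl : forall (k : R[i]) (x y : A), bmul (k *: x) y = k *: bmul x y;
  bmulZr : forall (k : R[i]) (x y : A), bmul x (k *: y) = k *: bmul x y;
  ler_normbM : forall x y : A, `|bmul x y| <= `|x| * `|y|
}.

#[short(type="banachAlgType")]
HB.structure Definition BanachAlgebra (R : realType) :=
  {A of CompleteNormedModule R[i] A & CompleteNormedModule_isBanachAlgebra R A}.

Notation "x ** y" := (bmul x y) (at level 40, left associativity) : ring_scope.

(* For M : R[i], `|f x| <= M * `|x| forces M to be real unless A = 0. *)
HB.mixin Record isBoundedHom (R : realType) (A B : banachAlgType R)
    (f : A -> B) := {
  bhomM : forall x y, f (x ** y) = f x ** f y;
  bhom_bounded : exists M : R[i], forall x, `|f x| <= M * `|x|
}.

HB.structure Definition BoundedHom (R : realType) (A B : banachAlgType R) :=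
  {f of @GRing.Linear R[i] A B *:%R f & isBoundedHom R A B f}.

Notation "{ 'bhom' A -> B }" := (@BoundedHom.type _ A%type B%type)
  (at level 0, A at level 98, B at level 99,
   format "{ 'bhom'  A  ->  B }") : type_scope.

(* R[i]^o is the complex line as a normed module over itself; continuity of psi
   is joint continuity on A * A. *)
Definition zero_product_determined (R : realType) (A : banachAlgType R) : Prop :=
  forall psi : {bilinear A -> A -> R[i]^o},
    continuous (fun p : A * A => psi p.1 p.2 : R[i]^o) ->
    (forall x y : A, x ** y = 0 -> psi x y = 0) ->
    exists2 tau : {linear A -> R[i]^o},
      continuous tau & forall x y : A, psi x y = tau (x ** y).

(* Approximate identities are two-sided and indexed by directed preorders. *)
Definition directed (I : Type) (le : I -> I -> Prop) : Prop :=
  [/\ inhabited I,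
      forall i, le i i,
      forall i j k, le i j -> le j k -> le i k
    & forall i j, exists k, le i k /\ le j k].

Definition tails (I : Type) (le : I -> I -> Prop) : set_system I :=
  [set P | exists i, forall j, le i j -> P j].

Definition has_bounded_approximate_identity (R : realType)
    (A : banachAlgType R) : Prop :=
  exists (I : Type) (le : I -> I -> Prop) (e : I -> A),
    [/\ directed le,
        exists M : R[i], forall i, `|e i| <= M,
        forall a : A, (e i ** a) @[i --> tails le] --> a
      & forall a : A, (a ** e i) @[i --> tails le] --> a].

(* The graph of phi as a Banach algebra.  The linear structure is inherited from
   A * B, but not the norm: the library puts the sup norm on a product, whereas
   the graph carries the sum of the two norms. *)
Section Graph.
Context (R : realType) (A B : banachAlgType R) (phi : {bhom A -> B}).

Definition graph_pred : {pred A * B} := [pred p | p.2 == phi p.1].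

Record graph := Graph { graph_val : A * B; _ : graph_val \in graph_pred }.

HB.instance Definition _ := [isSub for graph_val].
HB.instance Definition _ := [Choice of graph by <:].

Fact graph_submod_closed : submod_closed graph_pred.
Proof.
split=> [|k u v]; rewrite !inE /=; first by rewrite linear0.
by move=> /eqP-> /eqP->; rewrite linearP.
Qed.

HB.instance Definition _ :=
  GRing.isSubmodClosed.Build R[i] (A * B)%type graph_pred graph_submod_closed.
HB.instance Definition _ := [SubChoice_isSubLmodule of graph by <:].

Fact graphP (x : graph) : (val x).2 = phi (val x).1.
Proof. by case: x => /= u /eqP. Qed.

Fact graph_inj1 (x y : graph) : (val x).1 = (val y).1 -> x = y.
Proof.
move=> xy; apply: val_inj; rewrite [LHS]surjective_pairing graphP xy -graphP.
by rewrite -surjective_pairing.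
Qed.

Definition graph_norm (x : graph) : R[i] := `|(val x).1| + `|(val x).2|.

Fact ler_graph_normD (x y : graph) :
  graph_norm (x + y) <= graph_norm x + graph_norm y.
Proof. by rewrite /graph_norm raddfD addrACA lerD ?ler_normD. Qed.

Fact graph_normZ (k : R[i]) (x : graph) :
  graph_norm (k *: x) = `|k| * graph_norm x.
Proof. by rewrite /graph_norm linearZ /= !normrZ mulrDr. Qed.

Fact graph_norm0_eq0 (x : graph) : graph_norm x = 0 -> x = 0.
Proof.
move=> /eqP; rewrite paddr_eq0 ?normr_ge0 // => /andP[/eqP/normr0_eq0 x0 _].
by apply: graph_inj1; rewrite x0 raddf0.
Qed.

HB.instance Definition _ := Lmodule_isNormed.Build R[i] graph
  ler_graph_normD graph_normZ graph_norm0_eq0.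

Definition to_graph (a : A) : graph :=
  @Graph (a, phi a) (eqxx (phi a)).

Fact to_graphB (x : graph) (a : A) :
  `|x - to_graph a| = `|(val x).1 - a| + `|phi ((val x).1 - a)|.
Proof.
by rewrite -[LHS]/(graph_norm _) /graph_norm raddfB /= graphP linearB.
Qed.

Fact graph_complete (F : set_system graph) :
  ProperFilter F -> cauchy F -> cvg F.
Proof.
move=> FF /cauchy_ballP Fc.
pose p (x : graph) : A := (val x).1.
have pF : cvg (p @ F).
  apply: cauchy_cvg; apply/(@cauchy_ballP _ A) => e e0.
  have [[P Q] /= [FP FQ] PQ] := Fc e e0.
  exists (p @` P, p @` Q); first by split; [move: FP|move: FQ];
    apply: filterS => x; exists x.
  move=> [_ _] /= [[x Px <-] [y Qy <-]].
  have := PQ (x, y) (conj Px Qy); rewrite -!ball_normE /ball_ /=.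
  apply: le_lt_trans; rewrite -[leRHS]/(graph_norm _) /graph_norm raddfB /=.
  by rewrite lerDl normr_ge0.
have [a pa] := proj1 (cvg_ex _) pF.
have phi0 : continuous phi.
  apply: bounded_linear_continuous; apply/linear_boundedP => /=.
  have [M PM] := @bhom_bounded _ _ _ phi.
  near=> r => x; apply: le_trans (PM x) _.
  rewrite -[leLHS]ger0_norm ?(le_trans _ (PM x)) // normrM normr_id.
  by rewrite ler_wpM2r //; near: r; apply: nbhs_pinfty_ge; rewrite ?realE ?normr_ge0.
apply/cvg_ex; exists (to_graph a); apply/cvgrPdist_lt => e e0.
have ppa : phi (p x) @[x --> F] --> phi a.
  by apply: cvg_comp pa _; exact: phi0.
near=> x.
rewrite distrC to_graphB linearB /=  (splitr e) ltrD // distrC; near: x.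
  by move/cvgrPdist_lt : pa; apply; rewrite divr_gt0.
by move/cvgrPdist_lt : ppa; apply; rewrite divr_gt0.
Unshelve. all: by end_near. Qed.

HB.instance Definition _ := Uniform_isComplete.Build graph graph_complete.

Fact graph_mul_subproof (x y : graph) :
  ((val x).1 ** (val y).1, (val x).2 ** (val y).2) \in graph_pred.
Proof. by rewrite inE /= !graphP bhomM. Qed.

Definition graph_mul (x y : graph) : graph := Graph (graph_mul_subproof x y).

Fact graph_mulA : associative graph_mul.
Proof. by move=> x y z; apply: graph_inj1; exact: bmulA. Qed.

Fact graph_valD1 (x y : graph) : (val (x + y)).1 = (val x).1 + (val y).1.
Proof. by rewrite raddfD. Qed.

Fact graph_valZ1 (k : R[i]) (x : graph) : (val (k *: x)).1 = k *: (val x).1.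
Proof. by rewrite linearZ. Qed.

Fact graph_mulDl : left_distributive graph_mul +%R.
Proof.
move=> x y z; apply: graph_inj1.
by rewrite graph_valD1 -[LHS]/(_ ** _) graph_valD1 bmulDl.
Qed.

Fact graph_mulDr : right_distributive graph_mul +%R.
Proof.
move=> x y z; apply: graph_inj1.
by rewrite graph_valD1 -[LHS]/(_ ** _) graph_valD1 bmulDr.
Qed.

Fact graph_mulZl (k : R[i]) (x y : graph) :
  graph_mul (k *: x) y = k *: graph_mul x y.
Proof.
by apply: graph_inj1; rewrite graph_valZ1 -[LHS]/(_ ** _) graph_valZ1 bmulZl.
Qed.

Fact graph_mulZr (k : R[i]) (x y : graph) :
  graph_mul x (k *: y) = k *: graph_mul x y.
Proof.
by apply: graph_inj1; rewrite graph_valZ1 -[LHS]/(_ ** _) graph_valZ1 bmulZr.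
Qed.

Fact ler_norm_graphM (x y : graph) : `|graph_mul x y| <= `|x| * `|y|.
Proof.
rewrite -[leLHS]/(graph_norm _) -[`|x|]/(graph_norm _) -[`|y|]/(graph_norm _).
rewrite /graph_norm /= mulrDl !mulrDr -addrA lerD ?ler_normbM //.
rewrite (le_trans (ler_normbM _ _)) // addrA lerDr addr_ge0 ?mulr_ge0 //.
Qed.

HB.instance Definition _ := CompleteNormedModule_isBanachAlgebra.Build R graph
  graph_mulA graph_mulDl graph_mulDr graph_mulZl graph_mulZr ler_norm_graphM.

End Graph.

(* Main.v *)
Require Import Defs.
From HB Require Import structures.
From mathcomp Require Import all_boot all_order all_algebra.
From mathcomp Require Import complex.
From mathcomp Require Import all_classical all_reals all_analysis.

(** The map sending a to (a, phi a) is an algebra isomorphism of A onto the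
    graph.  It is bounded because phi is, and its inverse, the first
    coordinate, is contractive because the norm of the graph dominates that of
    A.  Being zero product determined is invariant under such isomorphisms, and
    even passes to retracts: if T : A -> C and S : C -> A are bounded
    homomorphisms with T (S z) = z, then a functional psi on C * C that
    vanishes on zero products pulls back along T to one on A * A, because T
    preserves zero products; if tau represents the pullback, then tau \o S
    represents psi, because S is multiplicative
    ([zero_product_determined_retract]). *)

Set Implicit Arguments.
Unset Strict Implicit.
Unset Printing Implicit Defensive.

Import Order.TTheory GRing.Theory Num.Theory.
Import numFieldNormedType.Exports.

Local Open Scope classical_set_scope.
Local Open Scope ring_scope.
Local Open Scope complex_scope.

Lemma bhom_continuous (R : realType) (A B : banachAlgType R)
  (f : {bhom A -> B}) : continuous f.
Proof.
apply: bounded_linear_continuous; apply/linear_boundedP => /=.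
have [M PM] := @bhom_bounded _ _ _ f.
near=> r => x; apply: le_trans (PM x) _.
(* M need not be real when A is trivial, so it is compared through its modulus. *)
rewrite -[leLHS]ger0_norm ?(le_trans _ (PM x)) // normrM normr_id.
by rewrite ler_wpM2r //; near: r;
  apply: nbhs_pinfty_ge; rewrite ?realE ?normr_ge0.
Unshelve. all: by end_near. Qed.

Section BilinearPullback.
Context (R : nzRingType) (U V : lmodType R) (W : lmodType R).
Context (psi : {bilinear V -> V -> W}) (T : {linear U -> V}).

Definition bilinear_pullback (x y : U) : W := psi (T x) (T y).

Lemma bilinear_pullback_is_bilinear :
  bilinear_for *:%R *:%R bilinear_pullback.
Proof.
split=> [y|x] k u v; rewrite /bilinear_pullback linearP.
  exact: linearPl.
exact: linearPr.
Qed.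

HB.instance Definition _ := bilinear_isBilinear.Build R U U W _ _
  bilinear_pullback bilinear_pullback_is_bilinear.

End BilinearPullback.

(** Multiplicativity of T makes the pullback of psi vanish on zero products;
    multiplicativity of S turns tau (S z ** S w) back into (tau \o S) (z ** w). *)
Lemma zero_product_determined_retract (R : realType) (A C : banachAlgType R)
    (T : {bhom A -> C}) (S : {bhom C -> A}) :
  cancel S T -> zero_product_determined A -> zero_product_determined C.
Proof.
move=> SK zpdA psi psi_cont psi0.
have [|x y xy0|tau tau_cont tauE] := zpdA (bilinear_pullback psi T).
- move=> p; pose TT (q : A * A) : C * C := (T q.1, T q.2).
  apply: (@continuous_comp _ _ _ TT (fun q => psi q.1 q.2 : R[i]^o)).
    apply: cvg_pair => /=.
      by apply: cvg_comp; [exact: cvg_fst|exact: bhom_continuous].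
    by apply: cvg_comp; [exact: cvg_snd|exact: bhom_continuous].
  exact: psi_cont.
- by apply: psi0; rewrite -bhomM xy0 linear0.
exists (tau \o S : {linear C -> R[i]^o}) => [z|z w] /=.
  by apply: continuous_comp; [exact: bhom_continuous|exact: tau_cont].
by rewrite -{1}[z]SK -{1}[w]SK bhomM -tauE.
Qed.

Section GraphIsomorphism.
Context (R : realType) (A B : banachAlgType R) (phi : {bhom A -> B}).

Lemma to_graph_is_linear : linear (to_graph phi).
Proof. by move=> k u v; apply: graph_inj1; rewrite graph_valD1 graph_valZ1. Qed.

HB.instance Definition _ :=
  GRing.isLinear.Build R[i] A (graph phi) *:%R (to_graph phi)
    to_graph_is_linear.

Lemma to_graphM (x y : A) :
  to_graph phi (x ** y) = to_graph phi x ** to_graph phi y.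
Proof. exact: graph_inj1. Qed.

Lemma to_graph_bounded :
  exists M : R[i], forall x, `|to_graph phi x| <= M * `|x|.
Proof.
have [M PM] := @bhom_bounded _ _ _ phi; exists (1 + M) => x.
by rewrite -[leLHS]/(graph_norm _) /graph_norm /= mulrDl mul1r lerD2l.
Qed.

HB.instance Definition _ :=
  isBoundedHom.Build R A (graph phi) (to_graph phi) to_graphM to_graph_bounded.

Definition graph_fst (x : graph phi) : A := (val x).1.

Lemma graph_fst_is_linear : linear graph_fst.
Proof. by move=> k x y; rewrite /graph_fst graph_valD1 graph_valZ1. Qed.

HB.instance Definition _ :=
  GRing.isLinear.Build R[i] (graph phi) A *:%R graph_fst graph_fst_is_linear.

Lemma graph_fstM (x y : graph phi) :
  graph_fst (x ** y) = graph_fst x ** graph_fst y.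
Proof. by []. Qed.

Lemma graph_fst_bounded :
  exists M : R[i], forall x, `|graph_fst x| <= M * `|x|.
Proof.
exists 1 => x; rewrite mul1r -[leRHS]/(graph_norm _) /graph_norm.
by rewrite lerDl.
Qed.

HB.instance Definition _ :=
  isBoundedHom.Build R (graph phi) A graph_fst graph_fstM graph_fst_bounded.

Lemma graph_fstK : cancel graph_fst (to_graph phi).
Proof. by move=> x; apply: graph_inj1. Qed.

End GraphIsomorphism.

Theorem proposition2 (R : realType) (A B : banachAlgType R)
    (phi : {bhom A -> B})
    (zpdA : zero_product_determined A)
    (baiA : has_bounded_approximate_identity A) :
  zero_product_determined (graph phi : banachAlgType R).
Proof.
exact: (@zero_product_determined_retract R A (graph phi) (to_graph phi)
  (@graph_fst R A B phi) (@graph_fstK R A B phi) zpdA).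
Qed.
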